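(* For $a,b,c,d,e,f\in\mathbb{C}$ let $T_{8D}(a,b,c,d,e,f)$ be the $8\times8$ matrix $$ \begin{bmatrix} 1 & -c & c & -e & -c & e & -e & c e \\ 1 & c & -e & c & -e & c & -e & -c e \\ c & -1 & c & e & -c & -e & c e & -e \\ c & 1 & e & c & e & c & c e & e \\ b & f & a d & a b & d f & b f & a b d & a d f \\ b & -f & a b & a d & -b f & -d f & a b d & -a d f \\ f & b & -a d & a b & -d f & b f & -a d f & -a b d \\ f & -b & a b & -a d & -b f & d f & -a d f & a b d \end{bmatrix}. $$ For $a,b,c\in\mathbb{T}$ define \begin{align*} A_1&=b c+a b c+b^2 c+b c^2,\qquad A_2=2 a b+a^2 b+a b^2+a c+b c+2 a b c,\\ B_1&=a b+a c+b c+a b c,\qquad B_2=2 (c-1)B_1,\qquad B_3=a b+c+2 a c+2 b c+a b c+c^2,\\ C&=(1+c)^2 A_2^2-4 a b B_3^2, \end{align*} and $d'=-A_1/B_1$, $e'=c\big((a - b) (a b - c) (1 + c) + \sqrt{C}\big)/B_2$, $f'=-\big((1 + c)A_2 + \sqrt{C}\big)/(2 B_3)$. Let $D=\{(a,b,c)\in\mathbb{T}^3 : C/(a^2b^2c^2)\text{ is a real number }\le 0,\ B_1\ne0,\ B_2\ne0,\ B_3\neq0\}$ and $\mathcal{S}_D(a,b,c)=T_{8D}(a,b,c,d',e',f')$. Then $T^{(3)}_{8D}:=\mathcal{S}_D(D)$ is a $3$-parameter family of complex Hadamard matrices.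
   Context: $\mathbb{T}=\{z\in\mathbb{C}:|z|=1\}$. A matrix $H\in M_n(\mathbb{T})$ is a complex Hadamard matrix of order $n$ if $HH^\dagger=nI$; the set of these is $\mathbb{H}(n)$. A $k$-parameter family of complex Hadamard matrices is a set $f(D)$ where $D\subseteq\mathbb{T}^k$ (parametrized by real angles, so regarded as a subset of $\mathbb{R}^k$) and $f:D\to\mathbb{H}(n)$ is continuous, such that $k$ equals the rank of the Jacobian matrix of $f$ (as a map from real parameters into $\mathbb{C}^{n\times n}\cong\mathbb{R}^{2n^2}$) at some interior point of $D$. Here $\sqrt{\cdot}$ denotes the principal branch of the complex square root, the same value of $\sqrt C$ being used in $e'$ and $f'$. *)

(* Defs.v *)
From HB Require Import structures.
From mathcomp Require Import all_boot all_order all_algebra.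
From mathcomp Require Import complex.
From mathcomp Require Import all_classical all_reals all_analysis.

Set Implicit Arguments.
Unset Strict Implicit.
Unset Printing Implicit Defensive.

Import Order.TTheory GRing.Theory Num.Theory.
Import numFieldNormedType.Exports.

Local Open Scope classical_set_scope.
Local Open Scope ring_scope.
Local Open Scope complex_scope.

Definition torus (R : realType) (k : nat) : set 'rV[R[i]]_k :=
  [set z : 'rV[R[i]]_k | forall j, `|z 0 j| = 1].

Definition hadamard (R : realType) (n : nat) : set 'M[R[i]]_n :=
  [set H : 'M[R[i]]_n | (forall i j, `|H i j| = 1) /\
           H *m (map_mx (@conjc R) H)^T = n%:R%:M].

Definition expi (R : realType) (k : nat) (theta : 'rV[R]_k) : 'rV[R[i]]_k :=
  map_mx (fun t => cos t +i* sin t) theta.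

(* A subset of the torus is regarded as a subset of R^k through its full
   (2 pi-periodic) preimage under expi.  Continuity on it is the same as
   continuity for the topology of the torus, since expi is a covering map. *)
Definition angles (R : realType) (k : nat) (D : set 'rV[R[i]]_k) :
  set 'rV[R]_k := @expi R k @^-1` D.

Definition real_coords (R : realType) (n : nat) (M : 'M[R[i]]_n) :
  'rV[R]_(n * n + n * n) :=
  row_mx (mxvec (map_mx (@complex.Re R) M)) (mxvec (map_mx (@complex.Im R) M)).

Definition in_angles (R : realType) (k n : nat)
  (f : 'rV[R[i]]_k -> 'M[R[i]]_n) (theta : 'rV[R]_k) :
  'rV[R]_(n * n + n * n) := real_coords (f (expi theta)).

(* This is a property of the set F alone: F has to be the image of some
   parametrization f, which is not part of the data.  Only the values of f on
   D matter, as theta is interior to angles D. *)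
Definition is_hadamard_family (R : realType) (n k : nat)
  (F : set 'M[R[i]]_n) : Prop :=
  exists (D : set 'rV[R[i]]_k) (f : 'rV[R[i]]_k -> 'M[R[i]]_n),
    [/\ D `<=` @torus R k,
        f @` D `<=` @hadamard R n,
        {within angles D, continuous (in_angles f)},
        (exists theta, [/\ (angles D)° theta,
             differentiable (in_angles f) theta &
             \rank (jacobian (in_angles f) theta) = k]) &
        F = f @` D].

Definition T8D (R : realType) (a b c d e f : R[i]) : 'M[R[i]]_8 :=
  \matrix_(i, j) nth 0 (nth [::] [::
    [:: 1; - c; c; - e; - c; e; - e; c * e];
    [:: 1; c; - e; c; - e; c; - e; - c * e];
    [:: c; - 1; c; e; - c; - e; c * e; - e];
    [:: c; 1; e; c; e; c; c * e; e];
    [:: b; f; a * d; a * b; d * f; b * f; a * b * d; a * d * f];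
    [:: b; - f; a * b; a * d; - b * f; - d * f; a * b * d; - a * d * f];
    [:: f; b; - a * d; a * b; - d * f; b * f; - a * d * f; - a * b * d];
    [:: f; - b; a * b; - a * d; - b * f; d * f; - a * d * f; a * b * d]
  ] i) j.

Definition T8D_A1 (R : realType) (a b c : R[i]) : R[i] :=
  b * c + a * b * c + b ^+ 2 * c + b * c ^+ 2.
Definition T8D_A2 (R : realType) (a b c : R[i]) : R[i] :=
  2 * a * b + a ^+ 2 * b + a * b ^+ 2 + a * c + b * c + 2 * a * b * c.
Definition T8D_B1 (R : realType) (a b c : R[i]) : R[i] :=
  a * b + a * c + b * c + a * b * c.
Definition T8D_B2 (R : realType) (a b c : R[i]) : R[i] :=
  2 * (c - 1) * T8D_B1 a b c.
Definition T8D_B3 (R : realType) (a b c : R[i]) : R[i] :=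
  a * b + c + 2 * a * c + 2 * b * c + a * b * c + c ^+ 2.
Definition T8D_C (R : realType) (a b c : R[i]) : R[i] :=
  (1 + c) ^+ 2 * T8D_A2 a b c ^+ 2 - 4 * a * b * T8D_B3 a b c ^+ 2.

Definition T8D_d (R : realType) (a b c : R[i]) : R[i] :=
  - T8D_A1 a b c / T8D_B1 a b c.
(* sqrtc is the principal branch: Re >= 0, and Im >= 0 on negative reals
   (the generic Num.sqrtC instead selects Im >= 0 everywhere). *)
Definition T8D_e (R : realType) (a b c : R[i]) : R[i] :=
  c * ((a - b) * (a * b - c) * (1 + c) + sqrtc (T8D_C a b c)) / T8D_B2 a b c.
Definition T8D_f (R : realType) (a b c : R[i]) : R[i] :=
  - ((1 + c) * T8D_A2 a b c + sqrtc (T8D_C a b c)) / (2 * T8D_B3 a b c).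

(* In R[i], x <= 0 means that x is real and nonpositive. *)
Definition T8D_dom (R : realType) : set 'rV[R[i]]_3 :=
  [set z : 'rV[R[i]]_3 | @torus R 3 z /\
    let a := z 0 0 in let b := z 0 1 in let c := z 0 2%:R in
    [/\ T8D_C a b c / (a ^+ 2 * b ^+ 2 * c ^+ 2) <= 0,
        T8D_B1 a b c != 0, T8D_B2 a b c != 0 & T8D_B3 a b c != 0]].

Definition S_D (R : realType) (z : 'rV[R[i]]_3) : 'M[R[i]]_8 :=
  let a := z 0 0 in let b := z 0 1 in let c := z 0 2%:R in
  T8D a b c (T8D_d a b c) (T8D_e a b c) (T8D_f a b c).

(* Main.v *)
Require Import Defs.
From mathcomp Require Import all_boot all_order all_algebra.
From mathcomp Require Import complex.
From mathcomp Require Import all_classical all_reals all_analysis.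
From mathcomp Require Import ring lra.

(* Write s for the square root of C.  For unimodular a, b, c the quotient
   C/(abc)^2 is real, and its being nonpositive means conj s = - s/(abc)^2.
   This makes d', e', f' unimodular, and conjugation on unimodular numbers is
   inversion, so that orthogonality of the rows of T8D amounts to four
   polynomial relations between a, ..., f, which follow from s^2 = C.

   The principal value of s jumps where abc crosses 1 or -1, so S_D is not
   continuous on its domain.  On the domain s = eps i abc r with
   r = sqrt (- C/(abc)^2) continuous and eps a sign.  Put a = al^3: every
   unimodular a has a cube root al with Re al > 0 and one with Re al < 0, so
   eps can be taken to be the sign of Re al.  In the parameters (al, b, c),
   restricted to the points where this s is the principal root, the same set of
   matrices is parametrized continuously.  Near (1, 1, -i), where C = 80, the
   parametrization is smooth, and the entries ab, b and c show that its Jacobian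
   has rank 3. *)

Set Implicit Arguments.
Unset Strict Implicit.
Unset Printing Implicit Defensive.

Import Order.TTheory GRing.Theory Num.Theory.
Import numFieldNormedType.Exports.

Local Open Scope classical_set_scope.
Local Open Scope ring_scope.
Local Open Scope complex_scope.

(** * Polynomial relations between the parameters *)

Section Relations.
Variables (R : realType) (a b c s : R[i]).
Hypothesis s2 : s ^+ 2 = T8D_C a b c.
Hypotheses (B1n0 : T8D_B1 a b c != 0) (B2n0 : T8D_B2 a b c != 0)
  (B3n0 : T8D_B3 a b c != 0).
Let d : R[i] := - T8D_A1 a b c / T8D_B1 a b c.
Let e : R[i] := c * ((a - b) * (a * b - c) * (1 + c) + s) / T8D_B2 a b c.
Let f : R[i] := - ((1 + c) * T8D_A2 a b c + s) / (2 * T8D_B3 a b c).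

(* Clearing denominators turns a relation that is linear in [e * f], [e], [f],
   with coefficients affine in [d], into a polynomial in [s] of degree 2; the
   right-hand side of the hypothesis carries its coefficient of [s ^+ 2]. *)
Lemma bilinear_relation (p0 p1 q0 q1 r0 r1 t0 t1 : R[i])
    (x := T8D_B1 a b c) (y := - T8D_A1 a b c)
    (u := c * ((a - b) * (a * b - c) * (1 + c) + s))
    (v := - ((1 + c) * T8D_A2 a b c + s)) :
  (p0 * x + p1 * y) * u * v + (q0 * x + q1 * y) * u * (2 * T8D_B3 a b c) +
  (r0 * x + r1 * y) * T8D_B2 a b c * v +
  (t0 * x + t1 * y) * T8D_B2 a b c * (2 * T8D_B3 a b c) =
    - c * (p0 * x + p1 * y) * (s ^+ 2 - T8D_C a b c) ->
  (p0 + p1 * d) * (e * f) + (q0 + q1 * d) * e + (r0 + r1 * d) * f +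
  (t0 + t1 * d) = 0.
Proof.
rewrite s2 subrr mulr0 /d /e /f -/x -/y -/u -/v => E.
rewrite -[RHS](mul0r (x * T8D_B2 a b c * (2 * T8D_B3 a b c))^-1) -E.
by field; rewrite B3n0 B2n0.
Qed.

(* Up to sign, the inner products of two distinct rows of [T8D] that do not
   vanish identically are the left-hand sides of [relation1] to [relation4]
   divided by [a * b * d * f]. *)
Lemma relation1 :
  (-1 - d) * (e * f) + (b * c + a * d) * e + (b * c + a * d) * f +
  (- (a * b * c) - a * b * c * d) = 0.
Proof.
rewrite -[RHS](@bilinear_relation (-1) (-1) (b * c) a (b * c) a
  (- (a * b * c)) (- (a * b * c))).
  by ring.
rewrite /T8D_C /T8D_B2 /T8D_A1 /T8D_A2 /T8D_B1 /T8D_B3; ring.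
Qed.

Lemma relation2 :
  (-1 - b) * (e * f) + (- (b * c) - a * b) * e + ((c + a) * d) * f +
  ((a * c + a * b * c) * d) = 0.
Proof.
rewrite -[RHS](@bilinear_relation (-1 - b) 0 (- (b * c) - a * b) 0 0 (c + a)
  0 (a * c + a * b * c)).
  by ring.
rewrite /T8D_C /T8D_B2 /T8D_A1 /T8D_A2 /T8D_B1 /T8D_B3; ring.
Qed.

Lemma relation3 :
  (- c - d) * (e * f) + (b + a * d) * e + (- (b * c) - a * c * d) * f +
  (a * b * c + a * b * d) = 0.
Proof.
rewrite -[RHS](@bilinear_relation (- c) (-1) b a (- (b * c)) (- (a * c))
  (a * b * c) (a * b)).
  by ring.
rewrite /T8D_C /T8D_B2 /T8D_A1 /T8D_A2 /T8D_B1 /T8D_B3; ring.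
Qed.

Lemma relation4 :
  (c + b) * (e * f) + (b + a * b) * e + ((c + a * c) * d) * f +
  ((a * c + a * b) * d) = 0.
Proof.
rewrite -[RHS](@bilinear_relation (c + b) 0 (b + a * b) 0 0 (c + a * c)
  0 (a * c + a * b)).
  by ring.
rewrite /T8D_C /T8D_B2 /T8D_A1 /T8D_A2 /T8D_B1 /T8D_B3; ring.
Qed.

End Relations.

(** * Unimodular complex numbers and conjugation *)

Section Modulus.
Variable F : rcfType.
Implicit Types x y : F[i].

Lemma conjcD x y : conjc (x + y) = conjc x + conjc y.
Proof. exact: rmorphD. Qed.
Lemma conjcN x : conjc (- x) = - conjc x.
Proof. exact: rmorphN. Qed.
Lemma conjcM x y : conjc (x * y) = conjc x * conjc y.
Proof. exact: rmorphM. Qed.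
Lemma conjcX x n : conjc (x ^+ n) = conjc x ^+ n.
Proof. exact: rmorphXn. Qed.
Definition conjcE := (conjcD, conjcN, conjcM, conjcX, @conjc_inv F,
  @conjc_nat F, @conjc1 F).

Lemma unimodularP x : `|x| = 1 <-> x * conjc x = 1.
Proof.
rewrite -sqr_normc; split=> [->|x1]; first by rewrite expr1n.
by apply/eqP; rewrite -(@eqrXn2 _ 2) ?normr_ge0// x1 expr1n.
Qed.

Lemma unimodular_neq0 x : `|x| = 1 -> x != 0.
Proof. by rewrite -normr_eq0 => ->; rewrite oner_eq0. Qed.

Lemma unimodular_conj x : `|x| = 1 -> conjc x = x^-1.
Proof.
move=> x1; apply: (mulfI (unimodular_neq0 x1)).
by rewrite (unimodularP x).1// divff// unimodular_neq0.
Qed.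

Lemma unimodular_div x y : y != 0 -> x * conjc x = y * conjc y -> `|x / y| = 1.
Proof.
move=> y0; rewrite -!sqr_normc => /eqP.
by rewrite eqrXn2 ?normr_ge0// normf_div => /eqP ->; rewrite divff ?normr_eq0.
Qed.

(** Such an [x] is purely imaginary: a real square forces one coordinate to vanish, and a
    nonpositive one excludes a nonzero real [x]. *)
Lemma conj_sqrt_le0 x : x ^+ 2 <= 0 -> conjc x = - x.
Proof.
case: x => u v; rewrite expr2 lecE /= => /andP[/eqP im_eq0 re_le0].
have u0 : u = 0.
  have /eqP : u * v = 0 by lra.
  by rewrite mulf_eq0 => /orP[/eqP//|/eqP v0]; rewrite v0 in re_le0; nra.
by rewrite u0; apply/eqP; rewrite eq_complex /= oppr0 !eqxx.
Qed.

End Modulus.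

(** * Unimodularity of d', e' and f' *)

Section UnimodularParameters.
Variables (R : realType) (a b c s : R[i]).
Hypotheses (a1 : `|a| = 1) (b1 : `|b| = 1) (c1 : `|c| = 1).
Hypotheses (s2 : s ^+ 2 = T8D_C a b c)
  (C_le0 : T8D_C a b c / (a ^+ 2 * b ^+ 2 * c ^+ 2) <= 0).

Let a0 : a != 0 := unimodular_neq0 a1.
Let b0 : b != 0 := unimodular_neq0 b1.
Let c0 : c != 0 := unimodular_neq0 c1.
Let conjE := (unimodular_conj a1, unimodular_conj b1, unimodular_conj c1).

(** The quotient [s / (a * b * c)] has a nonpositive square, hence is purely imaginary, and
    conjugation inverts [a * b * c]. *)
Lemma conj_root : @conjc (R : rcfType) s = - s / (a ^+ 2 * b ^+ 2 * c ^+ 2).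
Proof.
have /conj_sqrt_le0 : (s / (a * b * c)) ^+ 2 <= 0.
  by rewrite expr_div_n s2 !exprMn.
rewrite !conjcE !conjE => E.
transitivity (conjc s / (a^-1 * b^-1 * c^-1) / (a * b * c)).
  by field; rewrite a0 b0 c0.
by rewrite E; field; rewrite a0 b0 c0.
Qed.

(** [T8D_A1 a b c] is [b * c * (1 + a + b + c)], and the conjugate of [T8D_B1 a b c] is
    [(1 + a + b + c) / (a * b * c)], so both have the same modulus. *)
Lemma unimodular_d (B1n0 : T8D_B1 a b c != 0) :
  `|- T8D_A1 a b c / T8D_B1 a b c| = 1.
Proof.
apply: unimodular_div => //; rewrite /T8D_A1 /T8D_B1 !conjcE !conjE.
by field; rewrite a0 b0 c0.
Qed.

Lemma unimodular_e (B2n0 : T8D_B2 a b c != 0) :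
  `|c * ((a - b) * (a * b - c) * (1 + c) + s) / T8D_B2 a b c| = 1.
Proof.
apply: unimodular_div => //; apply/eqP; rewrite -subr_eq0; apply/eqP.
(* By [conj_root] the terms linear in [s] cancel in the difference of the squared moduli, which is
   then a multiple of [s ^+ 2 - T8D_C a b c]. *)
transitivity (- (s ^+ 2 - T8D_C a b c) / (a ^+ 2 * b ^+ 2 * c ^+ 2)).
  rewrite /T8D_B2 /T8D_B1 !conjcE !conjE conj_root.
  rewrite /T8D_C /T8D_A2 /T8D_B3.
  by field; rewrite a0 b0 c0.
by rewrite s2 subrr oppr0 mul0r.
Qed.

Lemma unimodular_f (B3n0 : T8D_B3 a b c != 0) :
  `|- ((1 + c) * T8D_A2 a b c + s) / (2 * T8D_B3 a b c)| = 1.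
Proof.
apply: unimodular_div; first by rewrite mulf_neq0// pnatr_eq0.
apply/eqP; rewrite -subr_eq0; apply/eqP.
transitivity (- (s ^+ 2 - T8D_C a b c) / (a ^+ 2 * b ^+ 2 * c ^+ 2)).
  rewrite /T8D_C /T8D_A2 /T8D_B3 !conjcE !conjE conj_root.
  by field; rewrite a0 b0 c0.
by rewrite s2 subrr oppr0 mul0r.
Qed.
End UnimodularParameters.

(** * From the relations to Hadamard matrices *)

Section Hadamard.
Variables (R : realType) (a b c d e f : R[i]).
Hypotheses (a1 : `|a| = 1) (b1 : `|b| = 1) (c1 : `|c| = 1)
  (d1 : `|d| = 1) (e1 : `|e| = 1) (f1 : `|f| = 1).
Hypotheses
  (rel1 : (-1 - d) * (e * f) + (b * c + a * d) * e + (b * c + a * d) * f +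
    (- (a * b * c) - a * b * c * d) = 0)
  (rel2 : (-1 - b) * (e * f) + (- (b * c) - a * b) * e + (c + a) * d * f +
    (a * c + a * b * c) * d = 0)
  (rel3 : (- c - d) * (e * f) + (b + a * d) * e + (- (b * c) - a * c * d) * f +
    (a * b * c + a * b * d) = 0)
  (rel4 : (c + b) * (e * f) + (b + a * b) * e + (c + a * c) * d * f +
    (a * c + a * b) * d = 0).

Lemma T8D_unimodular i j : `|T8D a b c d e f i j| = 1.
Proof.
rewrite mxE; case: i => [[|[|[|[|[|[|[|[|//]]]]]]]] ?];
  case: j => [[|[|[|[|[|[|[|[|//]]]]]]]] ?] /=;
  by rewrite ?(normrM, normrN, normr1, a1, b1, c1, d1, e1, f1, mulr1).
Qed.

Let a0 : a != 0 := unimodular_neq0 a1.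
Let b0 : b != 0 := unimodular_neq0 b1.
Let c0 : c != 0 := unimodular_neq0 c1.
Let d0 : d != 0 := unimodular_neq0 d1.
Let e0 : e != 0 := unimodular_neq0 e1.
Let f0 : f != 0 := unimodular_neq0 f1.
Let conjE := (unimodular_conj a1, unimodular_conj b1, unimodular_conj c1,
  unimodular_conj d1, unimodular_conj e1, unimodular_conj f1).

Lemma T8D_orthogonal (i j : 'I_8) : (i < j)%N ->
  \sum_k T8D a b c d e f i k * conjc (T8D a b c d e f j k) = 0.
Proof.
(* A nontrivial inner product is a relation divided by [m], up to sign; the two components serve the
   two signs. *)
have relE r (m := a * b * d * f) : r = 0 -> (r / m = 0) * (- r / m = 0).
  by move=> ->; rewrite oppr0 !mul0r.
(* Simplification computes the conjugates of the constants 1 and -1 as explicit pairs; these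
   equations fold them back. *)
have J1 : 1 -i* 0 = 1 :> R[i] by rewrite oppr0.
have JN1 : (-1) -i* (- 0) = -1 :> R[i].
  by apply/eqP; rewrite eq_complex /= !oppr0 !eqxx.
rewrite !big_ord_recl big_ord0 !mxE.
case: i => [[|[|[|[|[|[|[|[|//]]]]]]]] ?];
  case: j => [[|[|[|[|[|[|[|[|//]]]]]]]] ?] //= _;
  rewrite /= /bump ?add1n /= ?(conjcE, conjE, J1, JN1);
  first [ by field; rewrite ?a0 ?b0 ?c0 ?d0 ?e0 ?f0
        | by rewrite -[RHS](relE _ rel1).1; field; rewrite a0 b0 d0 f0
        | by rewrite -[RHS](relE _ rel1).2; field; rewrite a0 b0 d0 f0
        | by rewrite -[RHS](relE _ rel2).1; field; rewrite a0 b0 d0 f0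
        | by rewrite -[RHS](relE _ rel3).1; field; rewrite a0 b0 d0 f0
        | by rewrite -[RHS](relE _ rel3).2; field; rewrite a0 b0 d0 f0
        | by rewrite -[RHS](relE _ rel4).1; field; rewrite a0 b0 d0 f0
        | match goal with |- ?G => idtac G; idtac "--"  end].
Qed.

Lemma T8D_hadamard : @hadamard R 8 (T8D a b c d e f).
Proof.
split=> [i j|]; first exact: T8D_unimodular.
apply/matrixP => i j; rewrite !mxE.
under eq_bigr do rewrite [_^T _ _]mxE [map_mx _ _ _ _]mxE.
case: (ltngtP i j) => [lt_ij|lt_ji|/val_inj <-].
- by rewrite T8D_orthogonal// -val_eqE ltn_eqF.
(* Hermitian symmetry reduces this case to the previous one. *)
- rewrite -val_eqE gtn_eqF//= mulr0n.
  transitivity (conjc (\sum_k T8D a b c d e f j k *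
                              conjc (T8D a b c d e f i k))).
    rewrite (big_morph (@conjc R) (@conjcD R) (@conjc0 R)).
    by apply: eq_bigr => k _; rewrite conjcM conjcK mulrC.
  by rewrite T8D_orthogonal// conjc0.
- rewrite eqxx mulr1n -[in RHS](card_ord 8) -sumr_const.
  by apply: eq_bigr => k _; apply/unimodularP; exact: T8D_unimodular.
Qed.
End Hadamard.

Section DomainHadamard.
Variables (R : realType) (a b c s : R[i]).
Hypotheses (a1 : `|a| = 1) (b1 : `|b| = 1) (c1 : `|c| = 1).
Hypotheses (s2 : s ^+ 2 = T8D_C a b c)
  (C_le0 : T8D_C a b c / (a ^+ 2 * b ^+ 2 * c ^+ 2) <= 0)
  (B1n0 : T8D_B1 a b c != 0) (B2n0 : T8D_B2 a b c != 0)
  (B3n0 : T8D_B3 a b c != 0).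

Lemma T8D_solution_hadamard :
  @hadamard R 8 (T8D a b c (- T8D_A1 a b c / T8D_B1 a b c)
    (c * ((a - b) * (a * b - c) * (1 + c) + s) / T8D_B2 a b c)
    (- ((1 + c) * T8D_A2 a b c + s) / (2 * T8D_B3 a b c))).
Proof.
apply: T8D_hadamard => //.
- exact: unimodular_d.
- exact: unimodular_e.
- exact: unimodular_f.
- exact: relation1.
- exact: relation2.
- exact: relation3.
- exact: relation4.
Qed.
End DomainHadamard.

(** * Closure properties shared by continuity and differentiability *)

Section RegularFunctions.
Variables (T : Type) (R : realType).

(* Both "continuous at [t]" (within a set) and "differentiable at [t]" are
   instances of this interface. *)
Record regular_at (t : T) (P : (T -> R) -> Prop) : Prop := RegularAt {
  reg_cst : forall k : R, P (fun=> k);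
  regD : forall f g, P f -> P g -> P (fun x => f x + g x);
  regM : forall f g, P f -> P g -> P (fun x => f x * g x);
  regV : forall f, P f -> f t != 0 -> P (fun x => (f x)^-1);
  reg_sqrt : forall f, P f -> 0 < f t -> P (fun x => Num.sqrt (f x))
}.

Variables (t : T) (P : (T -> R) -> Prop).
Hypothesis Preg : regular_at t P.

Definition cregular (f : T -> R[i]) :=
  P (fun x => complex.Re (f x)) /\ P (fun x => complex.Im (f x)).

Lemma regN f : P f -> P (fun x => - f x).
Proof.
move=> Pf; under [X in P X]eq_fun do rewrite -mulN1r.
by apply: (regM Preg) => //; exact: (reg_cst Preg).
Qed.

Lemma cregular_cst (k : R[i]) : cregular (fun=> k).
Proof. by split; exact: (reg_cst Preg). Qed.

Lemma cregular_real f : P f -> cregular (fun x => (f x)%:C).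
Proof. by split => //; exact: (reg_cst Preg). Qed.

Lemma cregularD f g : cregular f -> cregular g -> cregular (fun x => f x + g x).
Proof.
move=> [Rf If] [Rg Ig]; split.
- rewrite (_ : (fun _ => _) =
    (fun x => complex.Re (f x) + complex.Re (g x))).
    exact: (regD Preg).
  by apply/funext => x; case: (f x) (g x) => ? ? [].
- rewrite (_ : (fun _ => _) =
    (fun x => complex.Im (f x) + complex.Im (g x))).
    exact: (regD Preg).
  by apply/funext => x; case: (f x) (g x) => ? ? [].
Qed.

Lemma cregularM f g : cregular f -> cregular g -> cregular (fun x => f x * g x).
Proof.
move=> [Rf If] [Rg Ig]; split.
- rewrite (_ : (fun _ => _) = (fun x =>
    complex.Re (f x) * complex.Re (g x) +
    - (complex.Im (f x) * complex.Im (g x)))).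
    by apply: (regD Preg); [|apply: regN]; exact: (regM Preg).
  by apply/funext => x; case: (f x) (g x) => ? ? [].
- rewrite (_ : (fun _ => _) = (fun x =>
    complex.Re (f x) * complex.Im (g x) +
    complex.Im (f x) * complex.Re (g x))).
    by apply: (regD Preg); exact: (regM Preg).
  by apply/funext => x; case: (f x) (g x) => ? ? [].
Qed.

Lemma cregularN f : cregular f -> cregular (fun x => - f x).
Proof.
move=> Pf; under [X in cregular X]eq_fun do rewrite -mulN1r.
by apply: cregularM => //; exact: cregular_cst.
Qed.

Lemma cregularX f n : cregular f -> cregular (fun x => f x ^+ n).
Proof.
move=> Pf; elim: n => [|n IH]; first exact: cregular_cst.
by under [X in cregular X]eq_fun do rewrite exprS; exact: cregularM.
Qed.

(** The inverse is the conjugate divided by the squared modulus [n], a real regular function that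
    does not vanish at [t]. *)
Lemma cregularV f : cregular f -> f t != 0 -> cregular (fun x => (f x)^-1).
Proof.
move=> [Rf If] f0.
pose n x := complex.Re (f x) * complex.Re (f x) +
            complex.Im (f x) * complex.Im (f x).
have Pn : P (fun x => (n x)^-1).
  apply: (regV Preg); first by apply: (regD Preg); exact: (regM Preg).
  move: f0; rewrite /n eq_complex /= negb_and -!expr2.
  move=> /orP[|] f0; rewrite gt_eqF//.
    by rewrite ltr_wpDr ?sqr_ge0// exprn_even_gt0.
  by rewrite ltr_wpDl ?sqr_ge0// exprn_even_gt0.
split.
- rewrite (_ : (fun _ => _) = (fun x => complex.Re (f x) * (n x)^-1)).
    exact: (regM Preg).
  by apply/funext => x; rewrite /n -!expr2; case: (f x).
- rewrite (_ : (fun _ => _) = (fun x => - (complex.Im (f x) * (n x)^-1))).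
    by apply: regN; exact: (regM Preg).
  by apply/funext => x; rewrite /n -!expr2; case: (f x).
Qed.

Lemma cregular_T8D (a b c d e f : T -> R[i]) i j :
  cregular a -> cregular b -> cregular c ->
  cregular d -> cregular e -> cregular f ->
  cregular (fun x => T8D (a x) (b x) (c x) (d x) (e x) (f x) i j).
Proof.
move=> Pa Pb Pc Pd Pe Pf; under [X in cregular X]eq_fun do rewrite mxE.
case: i => [[|[|[|[|[|[|[|[|//]]]]]]]] ?];
  case: j => [[|[|[|[|[|[|[|[|//]]]]]]]] ?] /=;
  by do ?[exact: cregular_cst | assumption | apply: cregularM
    | apply: cregularN].
Qed.

End RegularFunctions.

(** * Reparametrization by a cube root of a *)

Section Family.
Variable R : realType.
Implicit Types (z : 'rV[R[i]]_3) (t : 'rV[R]_3).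

Definition T8D_ratio (a b c : R[i]) : R[i] :=
  T8D_C a b c / (a ^+ 2 * b ^+ 2 * c ^+ 2).

(* [x / Num.sqrt (x ^+ 2)] is the sign of [x]. *)
Definition signed_root (x : R) (a b c : R[i]) : R[i] :=
  (x / Num.sqrt (x ^+ 2))%:C * (0 +i* 1) * (a * b * c) *
  (Num.sqrt (- complex.Re (T8D_ratio a b c)))%:C.

Definition T8D_family z : 'M[R[i]]_8 :=
  let a := z 0 0 ^+ 3 in let b := z 0 1 in let c := z 0 2%:R in
  let s := signed_root (complex.Re (z 0 0)) a b c in
  T8D a b c (- T8D_A1 a b c / T8D_B1 a b c)
    (c * ((a - b) * (a * b - c) * (1 + c) + s) / T8D_B2 a b c)
    (- ((1 + c) * T8D_A2 a b c + s) / (2 * T8D_B3 a b c)).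

Definition cube_first z : 'rV[R[i]]_3 :=
  \row_j (if j == 0 then z 0 0 ^+ 3 else z 0 j).

Lemma cube_firstE z : (cube_first z 0 0 = z 0 0 ^+ 3) *
  (cube_first z 0 1 = z 0 1) * (cube_first z 0 2%:R = z 0 2%:R).
Proof. by rewrite !mxE. Qed.

(** The sign of the real part is locally constant only away from zero, whence the second condition;
    the last one selects the branch taken by [S_D]. *)
Definition T8D_family_dom : set 'rV[R[i]]_3 :=
  [set z | [/\ @torus R 3 z, complex.Re (z 0 0) != 0,
    T8D_dom (cube_first z) &
    signed_root (complex.Re (z 0 0)) (z 0 0 ^+ 3) (z 0 1) (z 0 2%:R) =
    sqrtc (T8D_C (z 0 0 ^+ 3) (z 0 1) (z 0 2%:R))]].

Lemma family_domE z : T8D_family_dom z -> T8D_family z = S_D (cube_first z).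
Proof.
case=> _ _ _ E; rewrite /T8D_family /S_D /T8D_d /T8D_e /T8D_f.
by rewrite !cube_firstE E.
Qed.

Lemma expi_unimodular k (u : 'rV[R]_k) j : `|expi u 0 j| = 1 :> R[i].
Proof. by rewrite mxE normc_def /= cos2Dsin2 sqrtr1. Qed.

Section Regularity.
Variables (t : 'rV[R]_3) (P : ('rV[R]_3 -> R) -> Prop).
Hypothesis Preg : regular_at t P.
Hypothesis Pcos : forall j, P (fun u => cos (u 0 j)).
Hypothesis Psin : forall j, P (fun u => sin (u 0 j)).
Let A (u : 'rV[R]_3) : R[i] := expi u 0 0 ^+ 3.
Let B (u : 'rV[R]_3) : R[i] := expi u 0 1.
Let C (u : 'rV[R]_3) : R[i] := expi u 0 2%:R.

Lemma cregular_expi j : cregular P (fun u => expi u 0 j).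
Proof. by split; under [X in P X]eq_fun do rewrite mxE /=. Qed.

Lemma cregular_abc : [/\ cregular P A, cregular P B & cregular P C].
Proof. by split; [apply: (cregularX Preg)|..]; exact: cregular_expi. Qed.

Ltac creg := have [? ? ?] := cregular_abc;
  do ?[exact: (cregular_cst Preg) | assumption
  | apply: (cregularM Preg) | apply: (cregularD Preg)
  | apply: (cregularX Preg) | apply: (cregularN Preg)].

Lemma cregular_B1 : cregular P (fun u => T8D_B1 (A u) (B u) (C u)).
Proof. by rewrite /T8D_B1; creg. Qed.

Lemma cregular_B2 : cregular P (fun u => T8D_B2 (A u) (B u) (C u)).
Proof. by rewrite /T8D_B2 /T8D_B1; creg. Qed.

Lemma cregular_B3 : cregular P (fun u => T8D_B3 (A u) (B u) (C u)).
Proof. by rewrite /T8D_B3; creg. Qed.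

Lemma cregular_ratio : cregular P (fun u => T8D_ratio (A u) (B u) (C u)).
Proof.
rewrite /T8D_ratio /T8D_C /T8D_A2 /T8D_B3.
apply: (cregularM Preg); first by creg.
apply: (cregularV Preg); first by creg.
by rewrite !(mulf_neq0, expf_neq0)// unimodular_neq0// expi_unimodular.
Qed.

Hypothesis Psqrt :
  P (fun u => Num.sqrt (- complex.Re (T8D_ratio (A u) (B u) (C u)))).
Hypothesis cos_neq0 : complex.Re (expi t 0 0) != 0.

(** Regularity of the square root enters as [Psqrt] because the ratio may vanish on the domain,
    where [Num.sqrt] is continuous but not differentiable. The sign factor is regular by
    [cos_neq0]. *)
Lemma cregular_signed_root : cregular P (fun u =>
  signed_root (complex.Re (expi u 0 0)) (A u) (B u) (C u)).
Proof.
rewrite /signed_root; have [? ? ?] := cregular_abc.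
have Pre : P (fun u => complex.Re (expi u 0 0)) by case: (cregular_expi 0).
have Psign : P (fun u : 'rV[R]_3 => complex.Re (expi u 0 0) /
    Num.sqrt (complex.Re (expi u 0 0) ^+ 2)).
  apply: (regM Preg) => //; apply: (regV Preg).
    apply: (reg_sqrt Preg); last by rewrite exprn_even_gt0.
    by under [X in P X]eq_fun do rewrite expr2; exact: (regM Preg).
  by rewrite sqrtr_sqr normr_eq0.
by creg; exact: (cregular_real Preg).
Qed.

Hypotheses (B1n0 : T8D_B1 (A t) (B t) (C t) != 0)
  (B2n0 : T8D_B2 (A t) (B t) (C t) != 0)
  (B3n0 : T8D_B3 (A t) (B t) (C t) != 0).

Lemma regular_in_angles k : P (fun u => in_angles T8D_family u 0 k).
Proof.
have [? ? ?] := cregular_abc.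
have ? := cregular_signed_root; have ? := cregular_B3.
have entry i j : cregular P (fun u => T8D_family (expi u) i j).
  apply: (cregular_T8D Preg) => //.
  - rewrite /T8D_A1; apply: (cregularM Preg); first by creg.
    by apply: (cregularV Preg) => //; exact: cregular_B1.
  - apply: (cregularM Preg); last first.
      by apply: (cregularV Preg) => //; exact: cregular_B2.
    by creg.
  - apply: (cregularM Preg).
      by rewrite /T8D_A2; creg.
    apply: (cregularV Preg); last by rewrite mulf_neq0// pnatr_eq0.
    by creg.
rewrite /in_angles /real_coords.
case: (splitP k) => l kl.
- have -> : k = lshift _ l by exact: val_inj.
  under [X in P X]eq_fun do rewrite row_mxEl.
  case/mxvec_indexP: l {kl} => i j.
  under [X in P X]eq_fun do rewrite mxvecE mxE.
  by case: (entry i j).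
- have -> : k = rshift _ l by exact: val_inj.
  under [X in P X]eq_fun do rewrite row_mxEr.
  case/mxvec_indexP: l {kl} => i j.
  under [X in P X]eq_fun do rewrite mxvecE mxE.
  by case: (entry i j).
Qed.
End Regularity.
End Family.

(** * Continuity and differentiability as instances, and directional derivatives *)

Section RegularInstances.
Variable R : realType.

Lemma differentiable_of_derivable1 (V : normedModType R) (g : R -> R)
    (f : V -> R) (t : V) :
  derivable g (f t) 1 -> differentiable f t ->
  differentiable (fun x => g (f x)) t.
Proof. by move=> /derivable1_diffP dg df; exact: differentiable_comp. Qed.

Lemma differentiable_regular (V : normedModType R) (t : V) :
  regular_at t (fun f : V -> R => differentiable f t).
Proof.
split.
- by move=> k; exact: differentiable_cst.
- by move=> f g; exact: differentiableD.
- by move=> f g; exact: differentiableM.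
- by move=> f; exact: differentiableV.
- move=> f df f0; apply: differentiable_of_derivable1 => //.
  by have [] := is_derive1_sqrt f0.
Qed.

Lemma continuous_regular (T : topologicalType) (D : set T) (t : T) :
  regular_at t (fun f : T -> R => f x @[x --> within D (nbhs t)] --> f t).
Proof.
split.
- by move=> k; exact: cvg_cst.
- by move=> f g; exact: cvgD.
- by move=> f g; exact: cvgM.
- by move=> f cf f0; exact: cvgV.
- by move=> f cf _; apply: (cvg_comp _ _ cf); exact: sqrt_continuous.
Qed.

Lemma differentiable_rV (V : normedModType R) n (F : V -> 'rV[R]_n) (t : V) :
  (forall j, differentiable (fun x => F x 0 j) t) -> differentiable F t.
Proof.
move=> dF.
rewrite (_ : F = \sum_(j < n) (fun x => F x 0 j *: delta_mx 0 j)).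
  by apply: differentiable_sum => j; exact: differentiableZl.
by apply/funext => x; rewrite {1}[F x]row_sum_delta fct_sumE.
Qed.

Lemma cvg_rV (T : Type) (G : set_system T) {FG : Filter G} n
    (F : T -> 'rV[R]_n) (l : 'rV[R]_n) :
  (forall j, F x 0 j @[x --> G] --> l 0 j) -> F x @[x --> G] --> l.
Proof.
move=> cF; apply/cvgrPdist_lt => e e0.
have : \forall x \near G, forall j, `|l 0 j - F x 0 j| < e.
  apply: filter_forall => j; move/cvgrPdist_lt : (cF j); exact.
apply: filterS => x Fx; rewrite [ltLHS]/Num.Def.normr/= mx_normrE.
by apply/bigmax_ltP; split=> // -[i j] _; rewrite ord1 !mxE; exact: Fx.
Qed.

Lemma derive_coord n (u v : 'rV[R]_n) j :
  'D_v (fun w : 'rV[R]_n => w 0 j) u = v 0 j.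
Proof.
have := derive_id u v; rewrite derive_mx; last exact: derivable_id.
by move/rowP/(_ j); rewrite mxE.
Qed.

Lemma derive_comp1 (V : normedModType R) (g : R -> R) (f : V -> R)
    (u v : V) :
  derivable g (f u) 1 -> differentiable f u ->
  'D_v (fun w => g (f w)) u = 'D_v f u * 'D_1 g (f u).
Proof.
move=> dg df; have dg' : differentiable g (f u) by apply/derivable1_diffP.
rewrite !deriveE//; last exact: differentiable_comp.
rewrite (_ : (fun w => g (f w)) = g \o f)// diff_comp//=.
by rewrite (deriv1E dg) derive1E -deriveE// scale1r.
Qed.

End RegularInstances.

(** * Continuity and differentiability of the reparametrized family *)

Section FamilyRegularity.
Variable R : realType.
Implicit Types t u : 'rV[R]_3.

Lemma differentiable_cos_coord t j :
  differentiable (fun u : 'rV[R]_3 => cos (u 0 j)) t.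
Proof.
apply: differentiable_of_derivable1; first exact: derivable_cos.
exact: differentiable_coord.
Qed.

Lemma differentiable_sin_coord t j :
  differentiable (fun u : 'rV[R]_3 => sin (u 0 j)) t.
Proof.
apply: differentiable_of_derivable1; first exact: derivable_sin.
exact: differentiable_coord.
Qed.

Lemma T8D_family_continuous :
  {within angles (@T8D_family_dom R), continuous (in_angles (@T8D_family R))}.
Proof.
apply/subspace_continuousP => t Dt.
apply: cvg_rV => k.
have [_ cos0 [_ [_ B1 B2 B3]] _] := Dt.
have P := @continuous_regular R _ (angles (@T8D_family_dom R)) t.
have Pcoord (g : R -> R) j : continuous g ->
    g (u 0 j) @[u --> within (angles (@T8D_family_dom R)) (nbhs t)] -->
    g (t 0 j).
  move=> cg; apply: (cvg_comp (fun u : 'rV[R]_3 => u 0 j) g); last exact: cg.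
  apply: cvg_within_filter. exact: coord_continuous.
have Pcos j := Pcoord cos j (@continuous_cos R).
have Psin j := Pcoord sin j (@continuous_sin R).
rewrite !cube_firstE in B1 B2 B3.
apply: (regular_in_angles P Pcos Psin) => //.
(* Continuity of [Num.sqrt] at zero covers the points where the ratio vanishes. *)
have [+ _] := cregular_ratio P Pcos Psin.
move=> /cvgN cr.
by apply: (cvg_comp _ Num.sqrt cr); exact: sqrt_continuous.
Qed.

(** A strictly negative ratio keeps the argument of [Num.sqrt] in the region where it is
    differentiable. *)
Lemma T8D_family_differentiable t :
  let a : R[i] := expi t 0 0 ^+ 3 in
  let b : R[i] := expi t 0 1 in let c : R[i] := expi t 0 2%:R in
  complex.Re (expi t 0 0) != 0 -> complex.Re (T8D_ratio a b c) < 0 ->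
  T8D_B1 a b c != 0 -> T8D_B2 a b c != 0 -> T8D_B3 a b c != 0 ->
  differentiable (in_angles (@T8D_family R)) t.
Proof.
move=> a b c cos0 ratio_lt0 B1 B2 B3; apply: differentiable_rV => k.
have P := differentiable_regular t.
have Pcos := differentiable_cos_coord t.
have Psin := differentiable_sin_coord t.
apply: (regular_in_angles P Pcos Psin) => //.
apply: (reg_sqrt P); last by rewrite oppr_gt0.
by apply: (regN P); have [] := cregular_ratio P Pcos Psin.
Qed.
End FamilyRegularity.

(** * Cube roots of unimodular numbers *)

Section CubeRoot.
Variable R : realType.

Definition cis (x : R) : R[i] := cos x +i* sin x.

Lemma cisD x y : cis (x + y) = cis x * cis y.
Proof.
rewrite /cis cosD sinD; apply/eqP.
by rewrite eq_complex /= eqxx addrC [sin x * _]mulrC eqxx.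
Qed.

Lemma cisX x n : cis x ^+ n = cis (x *+ n).
Proof.
elim: n => [|n IH]; first by rewrite expr0 mulr0n /cis cos0 sin0.
by rewrite exprS IH mulrS cisD.
Qed.

Lemma cis_unimodular x : `|cis x| = 1.
Proof. by rewrite normc_def /= cos2Dsin2 sqrtr1. Qed.

(** [acos] of the real part has the right cosine and a nonnegative sine; the sign of the imaginary
    part decides between this angle and its opposite. *)
Lemma unimodular_cis (a : R[i]) : `|a| = 1 ->
  exists2 x, a = cis x & - pi <= x <= pi.
Proof.
case: a => x y /unimodularP; rewrite /= => /eqP.
rewrite eq_complex /= mulrN opprK => /andP[/eqP xy1 _].
have x1 : -1 <= x <= 1 by nra.
have [/andP[phi0 phi_pi] cosx] := acos_def x1.
have siny : sin (acos x) = `|y|.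
  by rewrite sin_acos// -sqrtr_sqr; congr Num.sqrt; lra.
case: (leP 0 y) => y0.
- exists (acos x); last by rewrite phi_pi (le_trans _ phi0)// oppr_le0 pi_ge0.
  by rewrite /cis cosx siny ger0_norm.
- exists (- acos x); last first.
    by rewrite lerN2 phi_pi (le_trans _ (pi_ge0 R))// oppr_le0.
  by rewrite /cis cosN sinN cosx siny ltr0_norm// opprK.
Qed.

(** A third of an angle in [-pi, pi] lies in [-pi/3, pi/3], where the cosine is positive. *)
Lemma cube_root_Re_gt0 (a : R[i]) : `|a| = 1 ->
  exists al, [/\ `|al| = 1, 0 < complex.Re al & al ^+ 3 = a].
Proof.
move=> /unimodular_cis[x -> /andP[xl xr]]; exists (cis (x / 3)).
have pi0 := pi_gt0 R.
split; first exact: cis_unimodular.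
- by rewrite /cis /= cos_gt0_pihalf//; apply/andP; split; lra.
- by rewrite cisX -[_ *+ 3]mulr_natr divfK// pnatr_eq0.
Qed.

(** Cubing is odd, so the opposite of a suitable cube root of [- a] works. *)
Lemma cube_root_Re_lt0 (a : R[i]) : `|a| = 1 ->
  exists al, [/\ `|al| = 1, complex.Re al < 0 & al ^+ 3 = a].
Proof.
rewrite -normrN => /cube_root_Re_gt0[al [al1 al0 al3]].
exists (- al); rewrite normrN; split=> //.
- by case: al al0 {al1 al3} => u v /=; rewrite oppr_lt0.
- by rewrite exprNn al3 -signr_odd /= expr1 mulN1r opprK.
Qed.

End CubeRoot.

(** * Equality of the images of the two parametrizations *)

Section Image.
Variable R : realType.

Lemma sign_gt0 (x : R) : 0 < x -> x / Num.sqrt (x ^+ 2) = 1.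
Proof. by move=> x0; rewrite sqrtr_sqr gtr0_norm// divff// gt_eqF. Qed.

Lemma sign_lt0 (x : R) : x < 0 -> x / Num.sqrt (x ^+ 2) = -1.
Proof.
by move=> x0; rewrite sqrtr_sqr ltr0_norm// invrN mulrN divff// lt_eqF.
Qed.

Lemma signed_rootN (x y : R) (a b c : R[i]) : 0 < x -> y < 0 ->
  signed_root y a b c = - signed_root x a b c.
Proof.
move=> x0 y0; rewrite /signed_root (sign_gt0 x0) (sign_lt0 y0).
by rewrite rmorphN !mulNr.
Qed.

(** The sign squares to 1 and the imaginary unit to -1, which leaves the ratio, real and
    nonpositive, times [(a * b * c) ^+ 2]. *)
Lemma signed_root_sqr (x : R) (a b c : R[i]) : x != 0 ->
  `|a| = 1 -> `|b| = 1 -> `|c| = 1 -> T8D_ratio a b c <= 0 ->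
  signed_root x a b c ^+ 2 = T8D_C a b c.
Proof.
move=> x0 a1 b1 c1 q0.
have abc0 : (a * b * c) ^+ 2 != 0.
  by rewrite expf_neq0// !mulf_neq0// unimodular_neq0.
have -> : T8D_C a b c = T8D_ratio a b c * (a * b * c) ^+ 2.
  by rewrite /T8D_ratio -!exprMn divfK.
have -> : T8D_ratio a b c = - (- complex.Re (T8D_ratio a b c))%:C.
  case: (T8D_ratio a b c) q0 => u v; rewrite lecE /= => /andP[/eqP <- _].
  by apply/eqP; rewrite eq_complex /= opprK oppr0 !eqxx.
have q0' : 0 <= - complex.Re (T8D_ratio a b c).
  by move: q0; rewrite lecE /= oppr_ge0 => /andP[].
have sg2 : (x / Num.sqrt (x ^+ 2)) ^+ 2 = 1.
  by rewrite expr_div_n sqr_sqrtr ?sqr_ge0// divff// expf_neq0.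
rewrite /signed_root !exprMn -!rmorphXn sg2 sqr_sqrtr// sqr_i.
by rewrite /= -!exprMn; ring.
Qed.

Lemma T8D_family_image :
  @S_D R @` @T8D_dom R = @T8D_family R @` @T8D_family_dom R.
Proof.
apply/seteqP; split => [_ [w Dw <-]|_ [z Dz <-]]; last first.
  exists (cube_first z); first by case: Dz.
  by rewrite family_domE.
have [w1 [q0 B1 B2 B3]] := Dw.
set a := w 0 0 in q0; set b := w 0 1 in q0; set c := w 0 2%:R in q0.
have [a1 b1 c1] : [/\ `|a| = 1, `|b| = 1 & `|c| = 1] by split; exact: w1.
have [al [al1 al0 al3]] : exists al : R[i], [/\ `|al| = 1,
    complex.Re al != 0, al ^+ 3 = a &
    signed_root (complex.Re al) a b c = sqrtc (T8D_C a b c)].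
  have [al [al1 al0 al3]] := cube_root_Re_gt0 a1.
  have [be [be1 be0 be3]] := cube_root_Re_lt0 a1.
  (* The signed roots attached to [al] and [be] are opposite and square to [T8D_C a b c], so one of
     them is the principal root. *)
  have : signed_root (complex.Re al) a b c ^+ 2 = sqrtc (T8D_C a b c) ^+ 2.
    by rewrite sqr_sqrtc signed_root_sqr// ?gt_eqF.
  move/eqP; rewrite eqf_sqr => /orP[] /eqP E.
  - by exists al; rewrite gt_eqF.
  - exists be; rewrite lt_eqF//; split=> //.
    by rewrite (signed_rootN _ _ _ al0 be0) E opprK.
move=> alE.
pose z : 'rV[R[i]]_3 := \row_j (if j == 0 then al else w 0 j).
have zE : cube_first z = w.
  apply/rowP => j; rewrite !mxE /=; case: eqP => [->|/eqP j0].
    by rewrite al3.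
  by [].
have Dz : T8D_family_dom z.
  split; rewrite ?zE ?mxE//=.
  - by move=> j; rewrite mxE; case: eqP.
  - by rewrite al3.
by exists z => //; rewrite family_domE// zE.
Qed.

Lemma T8D_dom_hadamard (w : 'rV[R[i]]_3) :
  T8D_dom w -> @hadamard R 8 (S_D w).
Proof.
move=> [w1 [q0 B1 B2 B3]].
by apply: T8D_solution_hadamard => //; exact: sqr_sqrtc.
Qed.

End Image.

(** * An interior point where the Jacobian has full rank *)

Section InteriorPoint.
Variable R : realType.
Implicit Types t u v : 'rV[R]_3.

(** The principal root has nonnegative real part, which rules out [- s]. *)
Lemma sqrtc_unique (x s : R[i]) :
  s ^+ 2 = x -> 0 < complex.Re s -> sqrtc x = s.
Proof.
move=> s2 s0; have : sqrtc x ^+ 2 == s ^+ 2 by rewrite sqr_sqrtc s2.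
rewrite eqf_sqr => /orP[/eqP//|/eqP E].
have : 0 <= complex.Re (sqrtc x) by case: (x) => p q; exact: sqrtr_ge0.
by rewrite E; case: s s0 {s2 E} => p q /= p0; rewrite oppr_ge0 leNgt p0.
Qed.

Lemma ratio_real (a b c : R[i]) : `|a| = 1 -> `|b| = 1 -> `|c| = 1 ->
  complex.Im (T8D_ratio a b c) = 0.
Proof.
move=> a1 b1 c1.
have conjE := (unimodular_conj a1, unimodular_conj b1, unimodular_conj c1).
have : conjc (T8D_ratio a b c) = T8D_ratio a b c.
  rewrite /T8D_ratio /T8D_C /T8D_A2 /T8D_B3 !(conjcE, conjE).
  by field; rewrite !unimodular_neq0.
case: (T8D_ratio a b c) => p q /eqP; rewrite eq_complex /= eqxx /= => /eqP.
lra.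
Qed.

Lemma near_gt0 (f : 'rV[R]_3 -> R) t :
  differentiable f t -> 0 < f t -> \forall u \near t, 0 < f u.
Proof.
move=> /differentiable_continuous cf.
by have /cvgr_gt := (cf : f u @[u --> t] --> f t); exact.
Qed.

(** One of the coordinates of [f t] is nonzero, and stays so nearby by continuity. *)
Lemma near_neq0 (f : 'rV[R]_3 -> R[i]) t :
  cregular (fun g => differentiable g t) f -> f t != 0 ->
  \forall u \near t, f u != 0.
Proof.
move=> [/differentiable_continuous cR /differentiable_continuous cI] f0.
have [R0|R0] := eqVneq (complex.Re (f t)) 0.
- have I0 : complex.Im (f t) != 0.
    by apply: contra_neq f0 => I0; apply/eqP; rewrite eq_complex R0 I0 /= eqxx.
  have /cvgr_neq0/(_ I0) := (cI : complex.Im (f u) @[u --> t] --> _).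
  by apply: filterS => u; apply: contra_neq => ->.
- have /cvgr_neq0/(_ R0) := (cR : complex.Re (f u) @[u --> t] --> _).
  by apply: filterS => u; apply: contra_neq => ->.
Qed.

(* At [(1, 1, -i)] one has [T8D_C = 80], a positive number, so that the branch
   cut of the square root is avoided. *)
Definition base_point : 'rV[R]_3 :=
  \row_j (if j == 2%:R then - (pi / 2) else 0).

Let c : R[i] := 0 +i* (-1).

Lemma expi_base_point :
  [/\ expi base_point 0 0 = 1 :> R[i], expi base_point 0 1 = 1 :> R[i] &
      expi base_point 0 2%:R = c].
Proof.
by split; rewrite !mxE /= ?cosN ?sinN ?cos_pihalf ?sin_pihalf ?cos0 ?sin0.
Qed.

Lemma c_sqr : c ^+ 2 = -1.
Proof.
rewrite expr2; apply/eqP; rewrite eq_complex /=.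
by apply/andP; split; apply/eqP; ring.
Qed.

Lemma ratio_base_point : T8D_ratio 1 1 c = (- 80%:R)%:C.
Proof.
rewrite rmorphN rmorph_nat.
rewrite /T8D_ratio !expr1n !mul1r c_sqr invrN1 mulrN1; congr (- _).
(* Division of [T8D_C 1 1 c], as a polynomial in [c], by [c ^+ 2 + 1] leaves the remainder 80. *)
transitivity (80%:R + (c ^+ 2 + 1) * (12%:R * c ^+ 2 + 16%:R * c - 68%:R)).
  by rewrite /T8D_C /T8D_A2 /T8D_B3; ring.
by rewrite c_sqr addNr mul0r addr0.
Qed.

Lemma B_base_point : [/\ T8D_B1 1 1 c != 0, T8D_B2 1 1 c != 0 &
  T8D_B3 1 1 c != 0].
Proof.
(* As [c ^+ 2 = -1], the factors [T8D_B1 1 1 c], [c - 1] and [T8D_B3 1 1 c] have explicit cofactors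
   giving the products 10, 2 and 6; [n] is the predecessor of the product. *)
have nat_neq0 n (x y : R[i]) : x * y = n.+1%:R -> x != 0.
  by apply: contra_eq_neq => ->; rewrite mul0r eq_sym pnatr_eq0.
have B1 : T8D_B1 1 1 c != 0.
  apply: (nat_neq0 9 _ (1 - 3 * c)).
  transitivity (1 - 9 * c ^+ 2 : R[i]); first by rewrite /T8D_B1; ring.
  by rewrite c_sqr; ring.
split=> //.
- rewrite /T8D_B2 !mulf_neq0// ?pnatr_eq0//.
  apply: (nat_neq0 1 _ (- (c + 1))).
  transitivity (1 - c ^+ 2 : R[i]); first by ring.
  by rewrite c_sqr; ring.
- apply: (nat_neq0 5 _ (- c)).
  transitivity (- (6 * c ^+ 2) - (1 + c ^+ 2) * c : R[i]).
    by rewrite /T8D_B3; ring.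
  by rewrite c_sqr; ring.
Qed.

(** The value is the square root of 80, since [c] is the inverse of the imaginary unit. Positivity
    persists nearby and identifies the principal root there. *)
Lemma signed_root_base_point :
  0 < complex.Re (signed_root (complex.Re (1 : R[i])) 1 1 c).
Proof.
rewrite /signed_root ratio_base_point sign_gt0 ?ltr01// !mul1r.
have -> : (0 +i* 1) * c = 1.
  by apply/eqP; rewrite eq_complex /=; apply/andP; split; apply/eqP; ring.
by rewrite mul1r /= sqrtr_gt0 opprK ltr0n.
Qed.

Let A (t : 'rV[R]_3) : R[i] := expi t 0 0 ^+ 3.
Let B (t : 'rV[R]_3) : R[i] := expi t 0 1.
Let C (t : 'rV[R]_3) : R[i] := expi t 0 2%:R.
Let root t := signed_root (complex.Re (expi t 0 0)) (A t) (B t) (C t).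

Lemma base_pointE : [/\ complex.Re (expi base_point 0 0) = 1,
  A base_point = 1, B base_point = 1 & C base_point = c].
Proof.
by have [a_eq b_eq c_eq] := expi_base_point; rewrite /A a_eq expr1n.
Qed.

Let D (g : 'rV[R]_3 -> R) := differentiable g base_point.
Let Dreg : regular_at base_point D := differentiable_regular base_point.
Let Dcos : forall j, D (fun u => cos (u 0 j)) :=
  differentiable_cos_coord base_point.
Let Dsin : forall j, D (fun u => sin (u 0 j)) :=
  differentiable_sin_coord base_point.

Lemma base_point_differentiable :
  differentiable (in_angles (@T8D_family R)) base_point.
Proof.
have [re_eq a_eq b_eq c_eq] := base_pointE.
have [B1 B2 B3] := B_base_point.
apply: T8D_family_differentiable; rewrite -/(A _) -/(B _) -/(C _).
- by rewrite re_eq oner_eq0.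
- by rewrite a_eq b_eq c_eq ratio_base_point /= oppr_lt0 ltr0n.
- by rewrite a_eq b_eq c_eq.
- by rewrite a_eq b_eq c_eq.
- by rewrite a_eq b_eq c_eq.
Qed.

(** All angles give points of the torus, where the ratio is real. The other conditions follow from
    strict inequalities or nonvanishing at the base point, which persist nearby; the branch
    condition comes from [sqrtc_unique]. *)
Lemma base_point_interior : (angles (@T8D_family_dom R))° base_point.
Proof.
have [re_eq a_eq b_eq c_eq] := base_pointE.
have [B1 B2 B3] := B_base_point.
have near_re : \forall u \near base_point, 0 < complex.Re (expi u 0 0).
  by apply: near_gt0; [case: (cregular_expi Dcos Dsin 0)|rewrite re_eq].
have near_B1 : \forall u \near base_point, T8D_B1 (A u) (B u) (C u) != 0.
  by apply: near_neq0; [exact: cregular_B1 Dreg Dcos Dsin|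
    rewrite a_eq b_eq c_eq].
have near_B2 : \forall u \near base_point, T8D_B2 (A u) (B u) (C u) != 0.
  by apply: near_neq0; [exact: cregular_B2 Dreg Dcos Dsin|
    rewrite a_eq b_eq c_eq].
have near_B3 : \forall u \near base_point, T8D_B3 (A u) (B u) (C u) != 0.
  by apply: near_neq0; [exact: cregular_B3 Dreg Dcos Dsin|
    rewrite a_eq b_eq c_eq].
have ratio_lt0 : 0 < - complex.Re (T8D_ratio (A base_point) (B base_point)
    (C base_point)).
  by rewrite a_eq b_eq c_eq ratio_base_point /= opprK ltr0n.
have Dratio : D (fun u => - complex.Re (T8D_ratio (A u) (B u) (C u))).
  by apply: (regN Dreg); have [] := cregular_ratio Dreg Dcos Dsin.
have near_ratio : \forall u \near base_point,
    0 < - complex.Re (T8D_ratio (A u) (B u) (C u)).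
  exact: near_gt0.
have near_root : \forall u \near base_point, 0 < complex.Re (root u).
  apply: near_gt0; last first.
    by rewrite /root re_eq a_eq b_eq c_eq; exact: signed_root_base_point.
  have [] // := cregular_signed_root Dreg Dcos Dsin; last first.
    by rewrite re_eq oner_eq0.
  exact: (reg_sqrt Dreg).
change (\forall u \near base_point, angles (@T8D_family_dom R) u).
near=> u.
have cu1 j : `|expi u 0 j| = 1 :> R[i] by exact: expi_unimodular.
have Au1 : `|A u| = 1 by rewrite normrX cu1 expr1n.
have [Bu1 Cu1] : `|B u| = 1 /\ `|C u| = 1 by split; exact: cu1.
have re0 : complex.Re (expi u 0 0) != 0 by rewrite gt_eqF//; near: u.
have ratio_le0 : T8D_ratio (A u) (B u) (C u) <= 0.
  rewrite lecE; apply/andP; split; first by rewrite ratio_real/=.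
  by rewrite ltW// -oppr_gt0; near: u.
split=> //.
- split; first by move=> j; rewrite mxE; case: eqP => // _; exact: cu1.
  rewrite !cube_firstE; split=> //; by near: u.
- by symmetry; apply: sqrtc_unique; [exact: signed_root_sqr|near: u].
Unshelve. all: by end_near. Qed.

(** The Jacobian has three rows, one per angle, so it suffices that a direction [v] killed by the
    differential is zero. The derivatives of three entries along [v] yield its coordinates. *)
Lemma base_point_rank :
  \rank (jacobian (in_angles (@T8D_family R)) base_point) = 3.
Proof.
apply/eqP; apply: inj_row_free => v; rewrite /jacobian mul_rV_lin1 => dF0.
have DF := base_point_differentiable.
have deriv0 k :
    'D_v (fun u : 'rV[R]_3 => in_angles (@T8D_family R) u 0 k) base_point = 0.
  move: dF0; rewrite -deriveE// derive_mx; last exact: diff_derivable.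
  by move/rowP/(_ k); rewrite !mxE.
have derivIm i j :
    'D_v (fun u : 'rV[R]_3 => complex.Im (T8D_family (expi u) i j) : R)
      base_point = 0.
  rewrite (_ : (fun _ => _) = (fun u => in_angles (@T8D_family R) u 0
    (rshift _ (mxvec_index i j)))); first exact: deriv0.
  apply/funext => u.
  by rewrite /in_angles /real_coords row_mxEr mxvecE [RHS]mxE.
have derivRe i j :
    'D_v (fun u : 'rV[R]_3 => complex.Re (T8D_family (expi u) i j) : R)
      base_point = 0.
  rewrite (_ : (fun _ => _) = (fun u => in_angles (@T8D_family R) u 0
    (lshift _ (mxvec_index i j)))); first exact: deriv0.
  apply/funext => u.
  by rewrite /in_angles /real_coords row_mxEl mxvecE [RHS]mxE.
(* Entry (4, 0) is [b]; its imaginary part has derivative cos 0 = 1 in the second angle. *)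
have v1 : v 0 1 = 0.
  have := derivIm (@Ordinal 8 4 isT) 0.
  rewrite (_ : (fun _ => _) = (fun u : 'rV[R]_3 => sin (u 0 1))); last first.
    by apply/funext => u; rewrite /T8D_family mxE /= mxE.
  rewrite derive_comp1; [|exact: derivable_sin|exact: differentiable_coord].
  by rewrite derive_coord derive_val !mxE /= cos0 mulr1.
(* Entry (4, 3) is [a * b], where [a] is the cube of the first parameter; this gives 3 times [v 0 0]
   plus [v 0 1]. *)
have v0 : v 0 0 = 0.
  have := derivIm (@Ordinal 8 4 isT) (@Ordinal 8 3 isT).
  rewrite (_ : (fun _ => _) =
      (fun u : 'rV[R]_3 => sin (3 * u 0 0 + u 0 1))); last first.
    apply/funext => u; rewrite /T8D_family mxE /=.
    by rewrite !mxE -!/(cis _) cisX -cisD /= mulr_natl.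
  pose f0 (u : 'rV[R]_3) := u 0 0; pose f1 (u : 'rV[R]_3) := u 0 1.
  have [df0 df1] : differentiable f0 base_point /\ differentiable f1 base_point.
    by split; exact: differentiable_coord.
  rewrite (@derive_comp1 _ _ sin (3 \*: f0 + f1)); first last.
  - by apply: differentiableD => //; exact: differentiableZ.
  - exact: derivable_sin.
  rewrite deriveD; [|exact/diff_derivable/differentiableZ|exact/diff_derivable].
  rewrite deriveZ; last exact/diff_derivable.
  have -> : (3 \*: f0 + f1) base_point = 0.
    by transitivity (3 * f0 base_point + f1 base_point) => //;
       rewrite /f0 /f1 !mxE /= mulr0 addr0.
  rewrite !derive_coord derive_val v1 addr0 cos0 mulr1.
  by move/eqP; rewrite scaler_eq0 pnatr_eq0 /= => /eqP.
(* Entry (0, 2) is [c]. At the angle -pi/2 the sine is stationary and the cosine has derivative 1,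
   hence the choice of the real part. *)
have v2 : v 0 2%:R = 0.
  have := derivRe 0 (@Ordinal 8 2 isT).
  rewrite (_ : (fun _ => _) = (fun u : 'rV[R]_3 => cos (u 0 2%:R))); last first.
    by apply/funext => u; rewrite /T8D_family mxE /= mxE.
  rewrite derive_comp1; [|exact: derivable_cos|exact: differentiable_coord].
  by rewrite derive_coord derive_val !mxE /= sinN sin_pihalf opprK mulr1.
suff: (v : 'rV[R]_3) = 0 by [].
apply/rowP => j; rewrite mxE; case: j => [[|[|[|//]]]] lt_j.
- by rewrite -v0; congr (v _ _); exact: val_inj.
- by rewrite -v1; congr (v _ _); exact: val_inj.
- by rewrite -v2; congr (v _ _); exact: val_inj.
Qed.

End InteriorPoint.

Theorem theorem4p4 (R : realType) :
  @is_hadamard_family R 8 3 (@S_D R @` @T8D_dom R).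
Proof.
exists (@T8D_family_dom R), (@T8D_family R); split.
- by move=> z [].
- by rewrite -T8D_family_image => _ [w Dw <-]; exact: T8D_dom_hadamard.
- exact: T8D_family_continuous.
- exists (base_point R); split.
  + exact: base_point_interior.
  + exact: base_point_differentiable.
  + exact: base_point_rank.
- exact: T8D_family_image.
Qed.
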